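(* For any odd integer $d\geq 7$, we have $$ e_{\mathrm{irr}}^*(d) \geq \frac{d}{2} + \frac{d-2}{4(d-1)} - 1. $$
   Context: The height $H(P)$ of an integer polynomial $P(x)$ (a polynomial in one variable with coefficients in $\mathbb{Z}$) is the maximum of the absolute values of its coefficients. For a separable integer polynomial $P(x)$ of degree $d\geq 2$ with distinct complex roots $\alpha_1,\ldots,\alpha_d$, set $$ \mathrm{sep}(P) = \min_{1\le i<j\le d} |\alpha_i-\alpha_j|, $$ and define the real number $e(P)$ (for $H(P)>1$) by $\mathrm{sep}(P) = H(P)^{-e(P)}$. For $d\geq 2$, set $$ e_{\mathrm{irr}}^*(d) := \limsup_{\deg(P)=d,\ H(P)\to+\infty} e(P), $$ where the limsup is taken over the monic irreducible integer polynomials $P(x)$ of degree $d$; that is, $e_{\mathrm{irr}}^*(d)$ is the limit as $N\to+\infty$ of the supremum of $e(P)$ over all monic irreducible integer polynomials $P$ of degree $d$ with $H(P)\geq N$. *)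

(* Defs.v *)
From mathcomp Require Export all_boot all_order all_algebra.
From mathcomp Require Export all_classical all_reals all_analysis.
From mathcomp Require Export complex.

Set Implicit Arguments.
Unset Strict Implicit.
Unset Printing Implicit Defensive.

Import Order.TTheory GRing.Theory Num.Theory ComplexField.

Local Open Scope classical_set_scope.
Local Open Scope ring_scope.

Definition height (P : {poly int}) : nat := \max_(i < size P) absz (P`_i)%R.

(* For monic P, irreducibility over Q and over Z agree by Gauss's lemma;
   irreducible_poly excludes constants. *)
Definition irreducible_intpoly (P : {poly int}) : Prop :=
  irreducible_poly (map_poly (intr : int -> rat) P).

Definition croot (R : realType) (P : {poly int}) : set R[i] :=
  [set z | root (map_poly (intr : int -> R[i]) P) z].

(* For separable P of degree at least 2, the set below is finite and nonempty,
   so that its infimum is its minimum; see sep_min. *)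
Definition sep (R : realType) (P : {poly int}) : R :=
  inf [set r | exists a b : R[i],
    [/\ croot P a, croot P b, a != b & r = Normc.normc (a - b)]].

(* The solution e of sep P = (height P) `^ (- e) when height P > 1;
   see sep_powR. *)
Definition sep_exp (R : realType) (P : {poly int}) : R :=
  - (ln (sep R P) / ln (height P)%:R).

Definition e_irr_star (R : realType) (d : nat) : \bar R :=
  lim ((fun N : nat =>
    ereal_sup [set (sep_exp R P)%:E | P in
      [set P : {poly int} | [/\ P \is monic, irreducible_intpoly P,
                                size P = d.+1 & (N <= height P)%N]]])
    @ \oo).

Lemma sep_min (R : realType) (P : {poly int}) (c : R[i]) (rs : seq R[i]) :
    c != 0 ->
    map_poly intr P = c *: \prod_(z <- rs) ('X - z%:P) ->
    uniq rs -> (1 < size rs)%N ->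
  (exists i j, [/\ (i < j < size rs)%N &
     sep R P = Normc.normc (rs`_i - rs`_j)]) /\
  (forall i j, (i < j < size rs)%N -> sep R P <= Normc.normc (rs`_i - rs`_j)).
Proof.
move=> c0 Prs urs srs.
have rootE z : croot P z <-> z \in rs.
  by rewrite /croot /= Prs rootZ// root_prod_XsubC.
pose D := [set r | exists a b : R[i],
  [/\ croot P a, croot P b, a != b & r = Normc.normc (a - b)]].
have normBC (a b : R[i]) : Normc.normc (a - b) = Normc.normc (b - a).
  by rewrite -normcN opprB.
have lbD : has_lbound D.
  by exists 0 => _ [a [b [_ _ _ ->]]]; case: (a - b) => x y; exact: sqrtr_ge0.
have memD i j : (i < j < size rs)%N -> D (Normc.normc (rs`_i - rs`_j)).
  move=> /andP[ij js]; have si := ltn_trans ij js.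
  exists rs`_i, rs`_j; split=> //; try exact/rootE/mem_nth.
  by rewrite nth_uniq// neq_ltn ij.
split; last by move=> i j ij; exact/ge_inf/memD.
pose n := size rs.
pose F (p : 'I_n * 'I_n) := Normc.normc (rs`_p.1 - rs`_p.2).
pose p0 : 'I_n * 'I_n := (Ordinal (ltnW srs), Ordinal srs).
pose Q (p : 'I_n * 'I_n) := (p.1 < p.2)%N.
have Qp0 : Q p0 by [].
case: (arg_minP F Qp0) => -[i j]; rewrite /Q /F /= => ij minij.
exists i, j; split; first by rewrite ij ltn_ord.
apply/eqP; rewrite eq_le; apply/andP; split.
  by apply: ge_inf => //; apply: memD; rewrite ij ltn_ord.
apply: lb_le_inf; first by exists (Normc.normc (rs`_i - rs`_j)); apply: memD; rewrite ij ltn_ord.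
move=> _ [a [b [/rootE ars /rootE brs ab ->]]].
have [ia ib] : (index a rs < n)%N /\ (index b rs < n)%N by rewrite !index_mem.
have := ab; rewrite -(nth_index 0 ars) -(nth_index 0 brs).
case: (ltngtP (index a rs) (index b rs)) => [lt|lt|->]; last by rewrite eqxx.
- by move=> _; exact: (minij (Ordinal ia, Ordinal ib)).
- by move=> _; rewrite normBC; exact: (minij (Ordinal ib, Ordinal ia)).
Qed.

Lemma sep_powR (R : realType) (P : {poly int}) (x : R) :
    (1 < height P)%N -> 0 < sep R P ->
  (sep R P = (height P)%:R `^ (- x)) <-> (x = sep_exp R P).
Proof.
move=> H1 s0.
have h1 : 1 < (height P)%:R :> R by rewrite ltr1n.
have lnh : ln (height P)%:R != 0 :> R by rewrite gt_eqF// ln_gt0.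
split=> [sE|->]; rewrite /sep_exp.
- by rewrite sE ln_powR mulfK// opprK.
- by rewrite opprK /powR gt_eqF ?(lt_trans ltr01)// divfK// lnK.
Qed.

(* Main.v *)
Require Import Defs.
From mathcomp Require Import polyrcf separable.
From mathcomp Require Import ring lra zify.

Import Order.TTheory GRing.Theory Num.Theory.

Local Open Scope ring_scope.

(* Let T be the truncation at degree d - 1 of the Catalan series, i.e. of the
   power series solution of t = x + t^2, so that T^2 - T + x = x^d G for a
   polynomial G.  For A = a^d, the polynomial
     Q_a(y) = y^d + 4 T(a y) + 4 A G(a y) - 2
   is monic, Eisenstein at 2, and has height of order a^(2d-2); with z = a y,
     z^d A Q_a(y) = (z^d + A (2 T(z) - 1))^2 - A^2 (1 - 4 z).
   For odd d the polynomial z^d + A (2 T(z) - 1) has a simple real root near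
   - 2 T_{d-1} A with derivative of order A^(d-1), whereas A^2 (1 - 4 z) is
   positive of order A^3 there.  Hence Q_a has two real roots at distance
   O(A^(5/2-d) / a) = O(a^(-(d-2)(2d-1)/2)).  Taking a = b^2 keeps all the
   exponents integral. *)

(** * Coefficients and values of polynomials *)

Lemma comp_polyZX (R : comNzRingType) (p : {poly R}) (c : R) i :
  (p \Po (c *: 'X))`_i = p`_i * c ^+ i.
Proof.
rewrite comp_polyE (eq_bigr (fun j : 'I__ => (p`_j * c ^+ j) *: 'X^j)); last first.
  by move=> j _; rewrite exprZn scalerA.
rewrite -(poly_def _ (fun j => p`_j * c ^+ j)) coef_poly; case: ltnP => // /(nth_default 0) ->.
by rewrite mul0r.
Qed.

Lemma horner_norm_le (R : realDomainType) (p : {poly R}) n (e x X : R) :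
  (size p <= n)%N -> (forall i, `|p`_i| <= e) -> `|x| <= X -> 1 <= X ->
  `|p.[x]| <= n%:R * e * X ^+ n.
Proof.
move=> sp pe xX X1; rewrite (horner_coef_wide _ sp).
apply: (le_trans (ler_norm_sum _ _ _)).
rewrite -mulrA mulr_natl -[X in _ <= _ *+ X]card_ord -sumr_const.
apply: ler_sum => i _; rewrite normrM normrX ler_pM ?exprn_ge0 //.
by rewrite (le_trans (lerXn2r _ _ _ xX)) ?nnegrE ?(le_trans _ xX) // ler_weXn2l // ltnW.
Qed.

Arguments horner_norm_le {R p n e x X}.

(** * Truncating the Catalan series *)

(** Fixed-point iteration of t |-> x + t^2 from 0. It converges x-adically to the Catalan series,
    and the n-th iterate is already correct through degree n. *)
Fixpoint cat_iter n : {poly int} :=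
  if n is m.+1 then 'X + cat_iter m ^+ 2 else 0.

Lemma cat_iter_coef_ge0 n i : 0 <= (cat_iter n)`_i.
Proof.
elim: n i => [|n IH] i /=; first by rewrite coef0.
rewrite coefD coefX expr2 coefM addr_ge0 ?ler0n // sumr_ge0 // => j _.
by rewrite mulr_ge0.
Qed.

Lemma cat_iter_coef_gt0 n i : (0 < i <= n)%N -> 0 < (cat_iter n)`_i.
Proof.
elim: n i => [|n IH] [|[|i]] //= hi; rewrite coefD coefX expr2 coefM.
  rewrite ltr_pwDl ?ltr01 // sumr_ge0 // => j _.
  by rewrite mulr_ge0 ?cat_iter_coef_ge0.
(* In the convolution, index 1 contributes the coefficient 1 times the coefficient [i.+1], both
   positive by induction. *)
rewrite add0r (bigD1 (Ordinal (isT : (1 < i.+3)%N))) //= subn1 /= ltr_pwDl //.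
  by rewrite mulr_gt0 // IH //; lia.
by rewrite sumr_ge0 // => j _; rewrite mulr_ge0 ?cat_iter_coef_ge0.
Qed.

(** By difference of squares: the sum of two consecutive iterates is divisible by x, so each
    iteration gains one power of x. *)
Lemma cat_iter_step n :
  exists g : {poly int}, cat_iter n.+1 - cat_iter n = g * 'X^(n.+1).
Proof.
have dvdX m : exists h : {poly int}, cat_iter m = h * 'X.
  elim: m => [|m [h IH]] /=; first by exists 0; rewrite mul0r.
  by exists (1 + h ^+ 2 * 'X); rewrite IH; ring.
elim: n => [|n [g IH]]; first by exists 1; rewrite /=; ring.
have [h1 e1] := dvdX n.+1; have [h0 e0] := dvdX n.
exists (g * (h1 + h0)).
have -> : cat_iter n.+2 - cat_iter n.+1 =
    (cat_iter n.+1 - cat_iter n) * (cat_iter n.+1 + cat_iter n) by rewrite /=; ring.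
by rewrite IH e1 e0 [in RHS]exprSr; ring.
Qed.

(** The iterate [cat_iter d] solves t = x + t^2 up to a multiple of x^(d+1), and cutting off its
    tail [D * 'X^d] costs a multiple of x^d. The bound on [G] is a degree count: T^2 - T + x has
    degree at most 2d - 2. *)
Lemma catalan_truncation d : (1 < d)%N -> exists T G : {poly int},
  [/\ T ^+ 2 - T + 'X = G * 'X^d, (size T <= d)%N, (size G < d)%N
    & 0 < T`_d.-1].
Proof.
move=> d1; have [g eg] := cat_iter_step d.
pose T := take_poly d (cat_iter d); pose D := drop_poly d (cat_iter d).
have sT : (size T <= d)%N by exact: size_take_poly.
have e : T = cat_iter d - D * 'X^d by rewrite -[in RHS](poly_take_drop d (cat_iter d)) addrK.
pose G : {poly int} := g * 'X + D ^+ 2 * 'X^d - D * cat_iter d *+ 2 + D.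
have eG : T ^+ 2 - T + 'X = G * 'X^d.
  have -> : T ^+ 2 - T + 'X = (cat_iter d.+1 - cat_iter d) +
     (D ^+ 2 * 'X^d - D * cat_iter d *+ 2 + D) * 'X^d by rewrite e /=; ring.
  by rewrite eg exprSr /G; ring.
exists T, G; split => //; last first.
  by rewrite coef_take_poly; case: ltnP => [_|]; [apply: cat_iter_coef_gt0; lia|lia].
have [->|G0] := eqVneq G 0; first by rewrite size_poly0; lia.
have : (size (T ^+ 2 - T + 'X)%R <= (d + d).-1)%N.
  rewrite (leq_trans (size_polyD _ _)) // geq_max size_polyX; apply/andP; split; last lia.
  rewrite (leq_trans (size_polyD _ _)) // geq_max size_polyN; apply/andP; split; last first.
    by apply: leq_trans sT _; lia.
  rewrite expr2; apply: leq_trans (size_polyMleq _ _) _; move: sT; move: (size T) => k; lia.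
rewrite eG size_mulXn //; move: (size G) => k; lia.
Qed.

(** * Pairs of close real roots *)

Lemma ivt_pair (R : rcfType) (f : {poly R}) (x d : R) : 0 < d ->
  f.[x] < 0 -> 0 < f.[x - d] -> 0 < f.[x + d] ->
  exists u v, [/\ x - d < u, u < v, v < x + d, f.[u] = 0 & f.[v] = 0].
Proof.
move=> d0 fx fl fr.
have [u] := @poly_ivtoo R f (x - d) x ltac:(lra) ltac:(by rewrite pmulr_rlt0).
rewrite in_itv /= => /andP[u1 u2] /rootP fu.
have [v] := @poly_ivtoo R f x (x + d) ltac:(lra) ltac:(by rewrite pmulr_llt0).
rewrite in_itv /= => /andP[v1 v2] /rootP fv.
by exists u, v; split=> //; lra.
Qed.

(* Substituting [z = - A * u] turns [z ^ d + A * s(z)] into a perturbation of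
   size [1 / A] of [u ^ (d - 1) * (u - c)], up to a factor [- A ^ d]. *)
Lemma perturbed_simple_root (R : rcfType) (m : nat) (c S : R) :
  2 <= c -> 0 <= S -> exists A0 : R, 1 <= A0 /\
  forall (A : R) (r : {poly R}), A0 <= A -> (size r <= m.+1)%N ->
    (forall i, `|r`_i| <= S / A) ->
  let phi := 'X^(m.+2) - c *: 'X^(m.+1) + r in
  let e := (4 * m.+2%:R)^-1 in
  exists u0 : R, [/\ `|u0 - c| <= e, phi.[u0] = 0 &
    forall h, 0 <= h -> h <= e ->
     h / 4 <= phi.[u0 + h] /\ h / 4 <= - phi.[u0 - h]].
Proof.
(* Within 2e of c, the factor d x - (d - 1) c = c + d (x - c) of the derivative stays at least c -
   1/2, and |x| <= [X]. *)
move=> c2 S0; set d : R := m.+2%:R; pose X := c + 1; pose e := (4 * d)^-1.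
have d2 : 2 <= d by rewrite /d ler_nat.
have e0 : 0 < e by rewrite /e invr_gt0; lra.
have de : d * e = 1 / 4 by rewrite /e; field; lra.
have e8 : e <= 1 / 8 by nra.
have X1 : 1 <= X by rewrite /X; lra.
pose E := d * (d * S) * X ^+ m.+2.
have d0 : 0 <= d by lra.
have X0 k : 0 <= X ^+ k by rewrite exprn_ge0 //; lra.
have E0 : 0 <= E by apply: mulr_ge0 (X0 _); do 2!apply: mulr_ge0 => //.
(* From this threshold on, E / A <= e / 2; and E / A bounds both [r] and its derivative on |x| <=
   X. *)
exists (1 + E * (2 / e)); split; first by rewrite lerDl mulr_ge0 // divr_ge0 //; lra.
move=> A r hA sr cr phi e'; rewrite {}/e' -/e.
have A0 : 0 < A by apply: lt_le_trans hA; rewrite ltr_pwDl // mulr_ge0 // divr_ge0 //; lra.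
have EA : E / A <= e / 2.
  rewrite ler_pdivrMr //; have : E * (2 / e) <= A by lra.
  by rewrite mulrA ler_pdivrMr // => h; lra.
have SA : 0 <= S / A by rewrite divr_ge0 // ltW.
have Xm k : (k <= m.+2)%N -> X ^+ k <= X ^+ m.+2 by move=> hk; rewrite ler_weXn2l.
have rE x : `|x| <= X -> `|r.[x]| <= e / 2.
  move=> xX; apply: (le_trans (horner_norm_le sr cr xX X1)); apply: le_trans EA.
  have -> : E / A = d * (d * (S / A)) * X ^+ m.+2 by rewrite /E; ring.
  have h1 : m.+1%:R <= d by rewrite /d ler_nat.
  apply: ler_pM => //; [by rewrite mulr_ge0| |exact: Xm].
  apply: ler_pM => //; rewrite -[leLHS]mul1r; apply: ler_pM => //; lra.
have rE' x : `|x| <= X -> `|r^`().[x]| <= e / 2.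
  move=> xX; have sr' : (size r^`() <= m.+1)%N.
    by rewrite (leq_trans (size_poly _ _)) ?(leq_trans (leq_pred _)).
  have cr' i : `|r^`()`_i| <= d * (S / A).
    rewrite coef_deriv normrMn -mulr_natl.
    have [hi|hi] := ltnP i m.+1.
      by apply: ler_pM => //; rewrite /d ler_nat ltnS ltnW.
    by rewrite nth_default ?(leq_trans sr) ?(leq_trans hi) // normr0 mulr0 mulr_ge0 //; lra.
  apply: (le_trans (horner_norm_le sr' cr' xX X1)); apply: le_trans EA.
  have -> : E / A = d * (d * (S / A)) * X ^+ m.+2 by rewrite /E; ring.
  apply: ler_pM => //; [by do 2!apply: mulr_ge0 => //| |by apply: Xm].
  apply: ler_wpM2r; first by rewrite mulr_ge0 //; lra.
  by rewrite /d ler_nat.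
have phiE x : phi.[x] = x ^+ m.+1 * (x - c) + r.[x].
  by rewrite /phi !hornerE !exprS; ring.
have phi'E x : phi^`().[x] = x ^+ m * (d * x - (d - 1) * c) + r^`().[x].
  have d1 : m.+1%:R = d - 1 by rewrite /d [m.+2%:R]mulrSr addrK.
  rewrite /phi derivD derivB derivZ !derivXn !succnK.
  rewrite hornerD hornerD hornerN hornerZ !hornerMn !hornerXn.
  rewrite -[_ *+ m.+2]mulr_natl -[_ *+ m.+1]mulr_natl d1 -/d exprS.
  move: (d) (x ^+ m) (r^`().[x]) => d' y z; ring.
have near x : `|x - c| <= 2 * e -> 1 <= x /\ `|x| <= X.
  by rewrite !ler_norml /X => /andP[h1 h2]; split; lra.
have slope x : `|x - c| <= 2 * e -> 1 / 4 <= phi^`().[x].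
  move=> hx; have [x1 xX] := near x hx; have := rE' x xX; rewrite phi'E.
  move: hx; rewrite !ler_norml => /andP[h1 h2] /andP[h3 h4].
  have h5 : 1 <= x ^+ m by rewrite exprn_ege1.
  have h6 : 1 / 2 <= d * x - (d - 1) * c by nra.
  nra.
(* Here x^(m+1) |x - c| >= e outweighs |r(x)| <= e / 2, so [phi] has the sign of x - c at both
   ends. *)
have side x : `|x - c| = e -> (0 < (x - c) * phi.[x]).
  move=> hx; have [x1 xX] : 1 <= x /\ `|x| <= X by apply: near; rewrite hx; lra.
  have := rE x xX; rewrite phiE.
  have h5 : 1 <= x ^+ m.+1 by rewrite exprn_ege1.
  rewrite ler_norml => /andP[h3 h4].
  by move: hx; case: (lerP 0 (x - c)) => h /eqP; rewrite ?(ger0_norm h) ?(ltr0_norm h) => /eqP hx; nra.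
have sr_ : 0 < phi.[c + e].
  by have := side (c + e); rewrite addrAC subrr add0r gtr0_norm // => /(_ erefl); rewrite pmulr_rgt0.
have sl_ : phi.[c - e] < 0.
  have := side (c - e); rewrite addrAC subrr add0r normrN gtr0_norm // => /(_ erefl).
  by rewrite mulNr -mulrN pmulr_rgt0 // oppr_gt0.
have [u] := @poly_ivtoo R phi (c - e) (c + e) ltac:(lra) ltac:(by rewrite pmulr_llt0).
rewrite in_itv /= => /andP[u1 u2] /rootP fu.
exists u; split=> //; first by rewrite ler_norml; apply/andP; split; lra.
move=> h; rewrite le_eqVlt => /predU1P[<-|h0] he.
  by rewrite addr0 subr0 fu oppr0 mul0r.
split.
  (* The segment from u to u + h stays within 2e of c, where the slope is at least 1/4; likewise for
     u - h below. *)
  have [x] := @poly_mvt R u (u + h) phi ltac:(lra).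
  rewrite in_itv /= => /andP[x1 x2]; rewrite fu subr0 => ->.
  have := slope x; rewrite ler_norml => /(_ ltac:(apply/andP; split; lra)) ?; nra.
have [x] := @poly_mvt R (u - h) u phi ltac:(lra).
rewrite in_itv /= => /andP[x1 x2]; rewrite fu sub0r => ->.
have := slope x; rewrite ler_norml => /(_ ltac:(apply/andP; split; lra)) ?; nra.
Qed.

(** With A = B^2 and x = - A u, [good x] becomes A^(2m+2) phi(u)^2 = 1 + 4 A u, with [phi] as in
    [perturbed_simple_root]. At the root of [phi] near c the right side is larger; at a distance h
    of order B^(-2m-1) on either side of it the left side is larger. So there is a solution on each
    side. *)
Lemma close_roots (R : rcfType) (m : nat) (s : {poly R}) :
  odd m -> (size s <= m.+2)%N -> 2 <= s`_m.+1 ->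
  exists D B0 : R, [/\ 0 < D, 0 < B0 & forall B, B0 <= B ->
    let good x := (x ^+ m.+2 + B ^+ 2 * s.[x]) ^+ 2 = B ^+ 4 * (1 - 4 * x) in
    exists z w, [/\ z < w, w < 0, w - z <= D * B ^+ 2 / B ^+ (2 * m).+1,
                    good z & good w]].
Proof.
move=> om ss; set c := s`_m.+1 => c2.
pose S := \sum_(i < m.+1) `|s`_i|.
have S0 : 0 <= S by apply: sumr_ge0.
have [A0 [A01 HA]] := @perturbed_simple_root R m c S c2 S0.
move: HA; set d : R := m.+2%:R => HA.
have d2 : 2 <= d by rewrite /d ler_nat.
(* Chosen so that K^2 A / 16 = K (4c + 5) A exceeds 1 + 4 A (c + 1). The threshold on B then ensures
   A >= A0 and h = K / B^(2m+1) <= e. *)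
pose K := 16 * (4 * c + 5).
exists (2 * K), (A0 + 4 * d * K).
have K0 : 0 < K by rewrite /K; lra.
have dK : 0 < d * K by apply: mulr_gt0 => //; lra.
split; [lra|lra|move=> B hB good].
have B1 : 1 <= B by lra.
have B0 : 0 < B by lra.
have [A AE] : {A | A = B ^+ 2} by exists (B ^+ 2).
have AB : B <= A by rewrite AE expr2; nra.
have A1 : 1 <= A by lra.
have A0' : 0 < A by lra.
(* The terms of A s(x) below degree m + 1, after x = - A u and division by - A^(m+2). As i <= m, at
   least one factor 1 / A remains. *)
pose r := \poly_(i < m.+1) (- ((- A) ^+ i * s`_i / A ^+ m.+1)).
have sr : (size r <= m.+1)%N by exact: size_poly.
have cr i : `|r`_i| <= S / A.
  rewrite coef_poly; case: ltnP => hi; last by rewrite normr0 divr_ge0 // ltW.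
  rewrite normrN !normrM normfV !normrX normrN (gtr0_norm A0').
  rewrite mulrAC mulrC; apply: ler_pM => //.
  - by rewrite divr_ge0 // exprn_ge0 // ltW.
  - by rewrite /S (bigD1 (Ordinal hi)) //= lerDl sumr_ge0.
  - rewrite ler_pdivrMr ?exprn_gt0 // exprS mulKf ?gt_eqF //.
    by rewrite ler_weXn2l.
have := HA A r ltac:(lra) sr cr.
set phi := _ + r; set e := _^-1 => /= -[u [uc phiu phih]].
have de : d * e = 1 / 4 by rewrite /e; field; lra.
have e0 : 0 < e by rewrite /e invr_gt0; lra.
have e8 : e <= 1 / 8 by nra.
have phiE x : (- A * x) ^+ m.+2 + A * s.[- A * x] = - A ^+ m.+2 * phi.[x].
  rewrite (horner_coef_wide _ ss) big_ord_recr /= -/c.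
  have -> : phi.[x] = x ^+ m.+2 - c * x ^+ m.+1 + r.[x].
    by rewrite /phi 2!hornerD hornerN hornerZ !hornerXn.
  have rx : A ^+ m.+1 * r.[x] = - \sum_(i < m.+1) s`_i * (- A * x) ^+ i.
    rewrite horner_poly mulr_sumr -sumrN; apply: eq_bigr => i _.
    rewrite exprMn; field; by rewrite expf_neq0 // gt_eqF.
  have := rx; move: (\sum_(i < m.+1) _) (r.[x]) => t y h.
  have {h} -> : t = - (A ^+ m.+1 * y) by rewrite h opprK.
  (* As m + 1 is even, only the power m + 2 changes sign, whence the common factor - A^(m+2). *)
  have sA1 : (- A) ^+ m.+1 = A ^+ m.+1 by rewrite exprNn -signr_odd /= om expr0 mul1r.
  by rewrite !exprMn [(- A) ^+ m.+2]exprS [x ^+ m.+2]exprS [A ^+ m.+2]exprS sA1; ring.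
have goodE x : A ^+ m.+1 * A ^+ m.+1 * phi.[x] ^+ 2 = 1 + 4 * A * x -> good (- A * x).
  move=> h; rewrite /good -AE phiE.
  have -> : B ^+ 4 = A ^+ 2 by rewrite AE -exprM.
  have -> : 1 - 4 * (- A * x) = 1 + 4 * A * x by ring.
  by rewrite -h [A ^+ m.+2]exprS; ring.
pose f := (A ^+ m.+1 * A ^+ m.+1) *: phi ^+ 2 - 1 - (4 * A) *: 'X.
have fE x : f.[x] = A ^+ m.+1 * A ^+ m.+1 * phi.[x] ^+ 2 - 1 - 4 * A * x.
  by rewrite /f 2!hornerD !hornerN !hornerZ hornerX horner_exp hornerC.
have fgood x : f.[x] = 0 -> good (- A * x).
  by rewrite fE => h; apply: goodE; lra.
pose h := K / B ^+ (2 * m).+1.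
have h0 : 0 < h by rewrite divr_gt0 // exprn_gt0.
have he : h <= e.
  rewrite /h ler_pdivrMr ?exprn_gt0 //.
  have : B <= B ^+ (2 * m).+1 by rewrite -[leLHS]expr1 ler_weXn2l.
  move: (B ^+ _) => b hb; nra.
have Ah : A ^+ m.+1 * A ^+ m.+1 * h ^+ 2 = K ^+ 2 * A.
  have -> : A ^+ m.+1 * A ^+ m.+1 = (B ^+ (2 * m).+1) ^+ 2 * A.
    by rewrite [B ^+ (2 * m).+1]exprSr exprM -AE exprS; move: (A ^+ m) => t; rewrite AE; ring.
  have : B ^+ (2 * m).+1 != 0 by rewrite expf_neq0 // gt_eqF.
  by rewrite /h; move: (B ^+ _) => b b0; field.
move: uc; rewrite ler_norml => /andP[u1 u2].
have big x y : x <= c + 1 -> h / 4 <= y -> y ^+ 2 = phi.[x] ^+ 2 -> 0 < f.[x].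
  move=> xc hy yx; rewrite fE -yx.
  have y2 : h ^+ 2 / 16 <= y ^+ 2 by nra.
  have A2 : 0 <= A ^+ m.+1 * A ^+ m.+1 by rewrite mulr_ge0 // exprn_ge0 // ltW.
  have : K ^+ 2 * A / 16 <= A ^+ m.+1 * A ^+ m.+1 * y ^+ 2.
    by rewrite -Ah -[leLHS]mulrA ler_wpM2l.
  move: (A ^+ m.+1 * A ^+ m.+1 * y ^+ 2) => t ht.
  have : K * A <= K ^+ 2 * A / 16 by rewrite /K in ht *; nra.
  have : 4 * A * x <= 4 * A * (c + 1) by rewrite ler_wpM2l //; lra.
  rewrite /K in ht *; nra.
have [p1 p2] := phih h (ltW h0) he.
have fu : f.[u] < 0 by rewrite fE phiu; nra.
have [||x [y [x1 xy y1 fx fy]]] := @ivt_pair R f u h h0 fu.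
- by apply: (big _ _ _ p2); [lra|rewrite sqrrN].
- by apply: (big _ _ _ p1); [lra|].
(* Multiplying by - A reverses the order and stretches y - x < 2h to less than 2 A h; both images
   are negative because u - h > 0. *)
exists (- A * y), (- A * x); split; [nra|nra| |exact: fgood|exact: fgood].
have -> : 2 * K * B ^+ 2 / B ^+ (2 * m).+1 = A * (2 * h) by rewrite /h -AE; ring.
nra.
Qed.

(** * Height, irreducibility and roots of the family *)

Lemma height_le (P : {poly int}) (c : int) :
  (forall i, `|P`_i| <= c) -> (height P)%:Z <= c.
Proof.
case: c => [n|n] h; last by have := le_trans (normr_ge0 _) (h 0%N).
by rewrite lez_nat; apply/bigmax_leqP => i _; rewrite -lez_nat abszE.
Qed.

Lemma coef_le_height (P : {poly int}) i : `|P`_i| <= (height P)%:Z.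
Proof.
rewrite -abszE lez_nat; have [hi|hi] := ltnP i (size P).
  exact: (leq_bigmax (Ordinal hi)).
by rewrite nth_default.
Qed.

(** The Q_a of the overview, grouped as y^d + 2 (2 (...) - 1) so that the Eisenstein conditions at 2
    can be read off. *)
Definition catalan_family (T G : {poly int}) (d : nat) (a : int) : {poly int} :=
  'X^d + 2 *: (2 *: ((T + a ^+ d *: G) \Po (a *: 'X)) - 1).

Lemma coef_catalan_family (T G : {poly int}) (d : nat) (a : int) i :
  (catalan_family T G d a)`_i = (i == d)%:R + 2 * (2 * ((T`_i + a ^+ d * G`_i) * a ^+ i) - (i == 0%N)%:R).
Proof.
by rewrite coefD coefXn !(coefZ, coefB) coef1 comp_polyZX coefD coefZ.
Qed.

Lemma size_catalan_family (T G : {poly int}) (d : nat) (a : int) :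
  (size T <= d)%N -> (size G < d)%N -> size (catalan_family T G d a) = d.+1.
Proof.
move=> sT sG; rewrite /catalan_family size_polyDl size_polyXn // ltnS.
apply/leq_sizeP => i di; rewrite !(coefZ, coefB) coef1 comp_polyZX coefD coefZ.
rewrite !nth_default ?(leq_trans _ di) // 1?ltnW //.
have -> : (i == 0%N) = false by case: i di => // /(leq_trans sG).
by rewrite !mulr0 addr0 mul0r mulr0.
Qed.

Lemma monic_catalan_family (T G : {poly int}) (d : nat) (a : int) :
  (size T <= d)%N -> (size G < d)%N -> catalan_family T G d a \is monic.
Proof.
move=> sT sG.
rewrite monicE lead_coefE size_catalan_family //= coef_catalan_family eqxx.
rewrite [T`_d]nth_default // [G`_d]nth_default // 1?ltnW //.
have -> : (d == 0%N) = false by apply: gtn_eqF; exact: leq_ltn_trans sG.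
by rewrite !mulr0 addr0 mul0r mulr0 addr0.
Qed.

Lemma irreducible_catalan_family (T G : {poly int}) (d : nat) (a : int) :
  (size T <= d)%N -> (size G < d)%N ->
  irreducible_intpoly (catalan_family T G d a).
Proof.
move=> sT sG.
have d0 : (0 < d)%N by exact: leq_ltn_trans sG.
apply/irreducible_rat_int; apply: (@eisenstein_crit 2) => //.
- by rewrite size_catalan_family // eqSS -lt0n.
- by rewrite (monicP (monic_catalan_family _ _ _ _ sT sG)).
(* The constant coefficient is 2 modulo 4. *)
- rewrite coef_catalan_family eq_sym (gtn_eqF d0) eqxx expr0 mulr1 add0r.
  apply/negP => /dvdzP[q]; rewrite expr2; lia.
- move=> i; rewrite size_catalan_family //= coef_catalan_family => /ltn_eqF ->.
  by rewrite add0r dvdz_mulr.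
Qed.

(** Since [G] has degree at most d - 2, the coefficient of degree d - 1 is 4 T_{d-1} a^(d-1). The
    bound is crude but forces the height to infinity. *)
Lemma height_catalan_family_ge (T G : {poly int}) (d : nat) (a : int) :
  (size G < d)%N -> (1 < d)%N -> 1 <= a -> 0 < T`_d.-1 ->
  a <= (height (catalan_family T G d a))%:Z.
Proof.
move=> sG d1 a1 T0; apply: le_trans (coef_le_height _ d.-1).
rewrite coef_catalan_family.
have -> : (d.-1 == d) = false by lia.
have -> : (d.-1 == 0%N) = false by lia.
have -> : G`_d.-1 = 0 by rewrite nth_default //; move: sG; move: (size G) => k; lia.
have ha : a <= a ^+ d.-1 by rewrite -[leLHS]expr1 ler_weXn2l //; lia.
apply: le_trans (ler_norm _); rewrite mulr0 addr0.
by move: (a ^+ _) (T`_ _) ha T0 => p t; nia.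
Qed.

Lemma height_catalan_family_le (T G : {poly int}) (d : nat) (a : int) :
  (size T <= d)%N -> (size G < d)%N -> 1 <= a ->
  (height (catalan_family T G d a))%:Z <= (3 + 4 * \sum_(i < d) (`|T`_i| + `|G`_i|)) * a ^+ (2 * d.-1).
Proof.
move=> sT sG a1; set S := \sum_(i < d) _; apply: height_le => i.
have a0 : 0 <= a by lia.
set M := a ^+ (2 * d.-1).
have M1 : 1 <= M by rewrite exprn_ege1.
(* An index i < k carries a^(j+i), of exponent at most 2(d - 1). For [G] this takes j = d and k = d
   - 1, by its size bound. *)
have cM (p : {poly int}) j k : (size p <= k)%N -> (j + k <= (2 * d.-1).+1)%N ->
    `|a ^+ j * p`_i * a ^+ i| <= `|p`_i| * M.
  move=> sp hk; have [hi|hi] := ltnP i (size p); last first.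
    by rewrite nth_default // mulr0 mul0r normr0 mul0r.
  rewrite !normrM (ger0_norm (exprn_ge0 _ a0)) (ger0_norm (exprn_ge0 _ a0)).
  rewrite mulrAC mulrC ler_wpM2l // /M -exprD ler_weXn2l //.
  by move: hi sp hk; move: (size p) => s; lia.
have hT := cM T 0%N d sT ltac:(lia).
have hG : `|a ^+ d * G`_i * a ^+ i| <= `|G`_i| * M by apply: (cM G d d.-1); lia.
have hS : `|T`_i| + `|G`_i| <= S.
  have [hi|hi] := ltnP i d.
    by rewrite /S (bigD1 (Ordinal hi)) //= lerDl sumr_ge0.
  rewrite (nth_default _ (leq_trans sT hi)) (nth_default _ (leq_trans (ltnW sG) hi)).
  by rewrite normr0 addr0 sumr_ge0.
(* The 3 absorbs the leading coefficient 1 and the constant - 2. *)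
have aux (x y t g t' g' s m : int) : 0 <= x <= 1 -> 0 <= y <= 1 ->
    `|t| <= t' -> `|g| <= g' -> t' + g' <= s -> 1 <= m ->
    `|x + 2 * (2 * (t + g) - y)| <= 3 * m + 4 * s by lia.
rewrite coef_catalan_family [_ * a ^+ i]mulrDl [leRHS]mulrDl -(mulrA 4 S).
apply: (aux _ _ _ _ (`|T`_i| * M) (`|G`_i| * M)) => //; [by case: eqP|by case: eqP| |].
  by move: hT; rewrite expr0 mul1r.
by rewrite -mulrDl ler_wpM2r // (le_trans ler01).
Qed.

Lemma root_catalan_family (T G : {poly int}) (d : nat) (a : int)
    (F : fieldType) (x : F) :
    T ^+ 2 - T + 'X = G * 'X^d -> a%:~R * x != 0 ->
  let z := a%:~R * x in let A := a%:~R ^+ d in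
  (z ^+ d + A * (map_poly intr (2 *: T - 1)).[z]) ^+ 2 = A ^+ 2 * (1 - 4 * z) ->
  root (map_poly intr (catalan_family T G d a)) x.
Proof.
move=> eTG z0 z A h.
have A0 : A != 0 by move: z0; rewrite mulf_eq0 negb_or => /andP[a0 _]; exact: expf_neq0.
apply/rootP; apply: (mulfI A0); apply: (mulfI (expf_neq0 d z0)).
rewrite -/z !mulr0.
have := congr1 (fun p => (map_poly (intr : int -> F) p).[z]) eTG.
rewrite /= rmorphD rmorphB rmorphXn rmorphM /= !map_polyXn map_polyX.
rewrite !(hornerD, hornerN, horner_exp, hornerM, hornerX, hornerXn).
have -> : (map_poly intr (catalan_family T G d a)).[x] =
    x ^+ d + 2 * (2 * ((map_poly intr T).[z] + A * (map_poly intr G).[z]) - 1).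
  rewrite /catalan_family rmorphD /= map_polyXn map_polyZ rmorphB rmorph1 /= map_polyZ map_comp_poly.
  rewrite [map_poly _ (T + _)]rmorphD /= !map_polyZ map_polyX.
  rewrite !(hornerD, hornerN, hornerZ, horner_comp, hornerX, hornerXn, hornerC).
  by rewrite /= rmorphXn.
move: h; rewrite rmorphB rmorph1 /= map_polyZ hornerD hornerN hornerZ hornerC /=.
have xd : A * x ^+ d = z ^+ d by rewrite /A /z exprMn.
rewrite [A * (x ^+ d + _)]mulrDr xd; move: (map_poly _ T).[z] (map_poly _ G).[z] => t g h1 h2.
(* The added last term vanishes by the Catalan equation [h2], evaluated at z. *)
transitivity ((z ^+ d + A * (2 * t - 1)) ^+ 2 - A ^+ 2 * (1 - 4 * z)
   + 4 * A ^+ 2 * (g * z ^+ d - (t ^+ 2 - t + z))); first by ring.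
by rewrite h1 h2; ring.
Qed.

(** * Separation of roots and the limsup *)

Lemma sep_le (R : realType) (P : {poly int}) (x y : R) :
  x < y -> root (map_poly intr P) x -> root (map_poly intr P) y ->
  sep R P <= y - x.
Proof.
move=> xy rx ry.
have mP : map_poly intr P = map_poly (real_complex R) (map_poly intr P).
  by rewrite -map_poly_comp; apply: eq_map_poly => n /=; rewrite rmorph_int.
have rC z : root (map_poly intr P) z -> croot P (real_complex R z).
  by rewrite /croot /= mP fmorph_root.
apply: ge_inf.
  by exists 0 => _ [a [b [_ _ _ ->]]]; case: (a - b) => u v; exact: sqrtr_ge0.
exists (real_complex R y), (real_complex R x); split; [exact: rC|exact: rC| |].
  by rewrite (inj_eq (fmorph_inj _)) gt_eqF.
by rewrite -rmorphB /= expr0n addr0 sqrtr_sqr gtr0_norm // subr_gt0.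
Qed.

(** A nonconstant gcd with p' would be p up to a unit, so p would divide p'; but in characteristic
    zero p' is nonzero of smaller degree. *)
Lemma irreducible_separable (F : numFieldType) (p : {poly F}) :
  irreducible_poly p -> separable_poly p.
Proof.
move=> [p1 irrp]; rewrite unlock coprimep_def; apply/negP => /negP g1.
have /eqp_dvdr gp := irrp _ g1 (dvdp_gcdl _ _).
have p' : p^`() != 0.
  have [k sp] : exists k, size p = k.+2 by move: p1; case: (size p) => [|[|k]] // _; exists k.
  apply/eqP => p'0; have /esym/eqP := coef_deriv p k.
  rewrite p'0 coef0 -mulr_natr mulf_eq0 pnatr_eq0 orbF.
  by have := lead_coef_eq0 p; rewrite lead_coefE sp => ->; rewrite -size_poly_eq0 sp.
have : p %| p^`() by rewrite (dvdp_trans _ (dvdp_gcdr p _)) // gp.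
move=> /(dvdp_leq p'); rewrite leqNgt lt_size_deriv //.
by apply: contraTneq p1 => ->; rewrite size_poly0.
Qed.

(** Separability passes from the rationals to R[i], so the minimum in [sep_min] is taken over
    distinct roots. Positivity allows taking logarithms in [sep_exp_ge]. *)
Lemma sep_gt0 (R : realType) (P : {poly int}) :
  irreducible_intpoly P -> (2 < size P)%N -> 0 < sep R P.
Proof.
move=> /irreducible_separable sP P2.
have mP : map_poly intr P = map_poly (ratr : rat -> R[i]) (map_poly intr P).
  by rewrite -map_poly_comp; apply: eq_map_poly => n /=; rewrite ratr_int.
have [rs Prs] := closed_field_poly_normal (map_poly intr P : {poly R[i]}).
have P0 : P != 0 by apply: contraTneq P2 => ->; rewrite size_poly0.
set c := lead_coef _ in Prs.
have sizeP : size (map_poly (intr : int -> R[i]) P) = size P.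
  by rewrite size_map_inj_poly //; exact: intr_inj.
have c0 : c != 0 by rewrite lead_coef_eq0 -size_poly_eq0 sizeP size_poly_eq0.
have urs : uniq rs.
  rewrite -separable_prod_XsubC -(eqp_separable (eqp_scale _ c0)) -Prs.
  by rewrite mP separable_map.
have srs : (1 < size rs)%N.
  have := sizeP; rewrite Prs size_scale // size_prod_XsubC => h.
  by move: P2; rewrite -h.
have [[i [j [/andP[ij js] ->]]] _] := sep_min c0 Prs urs srs.
rewrite lt_neqAle; apply/andP; split; last by case: (_ - _) => u v; exact: sqrtr_ge0.
rewrite eq_sym; apply/negP => /eqP/Normc.eq0_normc/eqP.
by rewrite subr_eq0 nth_uniq ?(ltn_trans ij) // ltn_eqF.
Qed.

(** The suprema decrease as N grows, so their limit exists, and a lower bound valid for every N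
    passes to it. *)
Lemma e_irr_star_ge (R : realType) (d : nat) (x : R) :
  (forall (N : nat) (e : R), 0 < e -> exists P : {poly int},
     [/\ P \is monic, irreducible_intpoly P, size P = d.+1,
         (N <= height P)%N & x - e <= sep_exp R P]) ->
  (x%:E <= e_irr_star R d)%E.
Proof.
move=> h; apply: lime_ge.
  apply: ereal_nonincreasing_is_cvgn => m n mn.
  by apply: le_ereal_sup => _ [P [mP iP sP hP] <-]; exists P => //; split=> //; exact: leq_trans hP.
near=> N; apply/lee_addgt0Pr => e e0.
have [P [mP iP sP hP xP]] := h N e e0.
rewrite -leeBlDr //; apply: (@le_trans _ _ (sep_exp R P)%:E).
  by rewrite -EFinB lee_fin.
by apply: ereal_sup_ubound; exists P.
Unshelve. all: by end_near.
Qed.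

(* With [l = ln b], [- ln sep] is at least [s * l - ln C1], and [ln H] lies
   between [l] and [h * l + ln C2]. *)
Lemma sep_exp_ge (R : realType) (s h : nat) (C1 C2 e : R) :
  (0 < h)%N -> 0 < C1 -> 1 <= C2 -> 0 < e -> exists b0 : R,
  forall (P : {poly int}) (b : nat), b0 <= b%:R -> (1 < b)%N -> 0 < sep R P ->
    sep R P <= C1 / b%:R ^+ s -> (b <= height P)%N ->
    (height P)%:R <= C2 * b%:R ^+ h ->
  s%:R / h%:R - e <= sep_exp R P.
Proof.
move=> h0 C10 C21 e0; set q : R := s%:R / h%:R.
have q0 : 0 <= q by rewrite divr_ge0.
have qh : q * h%:R = s%:R by rewrite /q divfK // pnatr_eq0 -lt0n.
(* Beyond this threshold e * ln b absorbs the contribution of both constants. *)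
exists (expR ((ln C1 + q * ln C2) / e)) => P b hb b1 S0 hS bH hH.
have b0 : 0 < b%:R :> R by rewrite ltr0n ltnW.
have H1 : 1 < (height P)%:R :> R by rewrite ltr1n (leq_trans b1).
have H0 : 0 < (height P)%:R :> R by lra.
have lb : (ln C1 + q * ln C2) / e <= ln b%:R :> R.
  by rewrite -[leLHS]expRK ler_ln ?posrE ?expR_gt0.
have {}lb : ln C1 + q * ln C2 <= e * ln b%:R by rewrite [e * _]mulrC -ler_pdivrMr.
have lS : ln (sep R P) <= ln C1 - s%:R * ln b%:R.
  rewrite mulr_natl -lnXn // -ln_div ?posrE ?exprn_gt0 //.
  by rewrite ler_ln ?posrE ?divr_gt0 ?exprn_gt0.
have lH : ln (height P)%:R <= ln C2 + h%:R * ln b%:R :> R.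
  rewrite mulr_natl -lnXn // -lnM ?posrE ?exprn_gt0 //; last lra.
  by rewrite ler_ln ?posrE ?mulr_gt0 ?exprn_gt0 //; lra.
have lHb : ln b%:R <= ln (height P)%:R :> R by rewrite ler_ln ?posrE ?ler_nat.
have lH0 : 0 < ln (height P)%:R :> R by rewrite ln_gt0.
rewrite /sep_exp -mulNr ler_pdivlMr // mulrBl.
have : q * ln (height P)%:R <= q * ln C2 + s%:R * ln b%:R.
  by rewrite -qh -mulrA -mulrDr ler_wpM2l.
have : e * ln b%:R <= e * ln (height P)%:R by rewrite ler_pM2l.
lra.
Qed.

(** * Exponents for the family with a = b^2 *)

Theorem theorem2 (R : realType) (d : nat) (hodd : odd d) (hd : (7 <= d)%N) :
  ((d%:R / 2 + (d%:R - 2) / (4 * (d%:R - 1)) - 1 : R)%:E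
     <= e_irr_star R d)%E.
Proof.
have [m dm] : exists m, d = m.+2 by exists (d - 2)%N; lia.
have d1 : (1 < d)%N by lia.
have [T [G [eTG sT sG T0]]] := catalan_truncation d d1.
have T1 : 1 <= T`_d.-1 by lia.
pose s : {poly R} := map_poly intr (2 *: T - 1).
have ss : (size s <= m.+2)%N.
  rewrite (leq_trans (size_poly _ _)) // (leq_trans (size_polyD _ _)) //.
  by rewrite geq_max size_polyN size_poly1 (leq_trans (size_scale_leq _ _)) // -dm.
have s2 : 2 <= s`_m.+1.
  rewrite coef_map_id0 // coefB coefZ coef1 subr0 -[2](_ : 2%:~R = _) // ler_int.
  by move: T1; rewrite dm /=; move: (T`_m.+1) => t; lia.
have om : odd m by move: hodd; rewrite dm /= negbK.
have [D [B0 [D0 B00 hB]]] := close_roots _ _ _ om ss s2.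
pose C2 : R := (3 + 4 * \sum_(i < d) (`|T`_i| + `|G`_i|))%:~R.
have C21 : 1 <= C2.
  rewrite -[1](_ : 1%:~R = _) // ler_int.
  have : 0 <= \sum_(i < d) (`|T`_i| + `|G`_i|) by rewrite sumr_ge0.
  move: (\sum_(i < d) _) => S; lia.
apply: e_irr_star_ge => N e e0.
(* With d = m + 2, these are the exponents of b in sep = O(b^(-(d-2)(2d-1))) and in the height
   O(b^(4(d-1))); their quotient is the claimed bound. *)
have [b0 hb0] := sep_exp_ge R (m * (2 * m + 3)) (4 * m.+1) D C2 e isT D0 C21 e0.
pose b := (Num.truncn (Num.max b0 B0) + N + 2)%N.
have hb : b0 <= b%:R /\ B0 <= b%:R.
  have : Num.max b0 B0 <= b%:R.
    apply/ltW/(lt_le_trans (truncnS_gt _)); rewrite ler_nat /b; move: (Num.truncn _) => t; lia.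
  by rewrite ge_max => /andP.
have b2 : (1 < b)%N by rewrite /b; lia.
have Nb : (N <= b)%N by rewrite /b; lia.
move: {hb} b hb b2 Nb => b [hb1 hb2] b2 Nb.
pose a : int := b%:Z ^+ 2.
have ba : b%:Z <= a by rewrite /a expr2; nia.
have a1 : 1 <= a by lia.
pose Q := catalan_family T G d a.
have irrQ : irreducible_intpoly Q by exact: irreducible_catalan_family.
have sQ : size Q = d.+1 by exact: size_catalan_family.
have bH : (b <= height Q)%N.
  by rewrite -lez_nat (le_trans ba) // height_catalan_family_ge.
exists Q; split=> //; [exact: monic_catalan_family|exact: leq_trans bH|].
have -> : d%:R / 2 + (d%:R - 2) / (4 * (d%:R - 1)) - 1
   = (m * (2 * m + 3))%:R / (4 * m.+1)%:R :> R.
  rewrite dm !natrM natrD natrM -[m.+2]addn2 -[m.+1]addn1 !natrD; field.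
  by have : 0 <= m%:R :> R by []; move: (m%:R : R) => t t0; rewrite gt_eqF //; lra.
have bR : 1 < b%:R :> R by rewrite ltr1n.
apply: (hb0 Q b) => //.
- by rewrite sep_gt0 // sQ ltnS.
(* With this choice B^2 = a^d, the A of the overview. *)
- pose B : R := b%:R ^+ d.
  have B0B : B0 <= B.
    by rewrite (le_trans hb2) // -[leLHS]expr1 ler_weXn2l ?(ltW bR) // ltnW.
  have [z [w [zw w0 wz gz gw]]] := hB B B0B.
  pose ar : R := b%:R ^+ 2.
  have arE : a%:~R = ar by rewrite /a rmorphXn.
  have ar0 : 0 < ar by rewrite exprn_gt0 //; lra.
  have rt x : x < 0 -> (x ^+ m.+2 + B ^+ 2 * s.[x]) ^+ 2 = B ^+ 4 * (1 - 4 * x) ->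
      root (map_poly intr Q) (x / ar).
    move=> x0 hx; have xE : a%:~R * (x / ar) = x by rewrite arE mulrC divfK ?gt_eqF.
    apply: root_catalan_family; rewrite ?xE // ?lt_eqF //.
    have -> : a%:~R ^+ d = B ^+ 2 by rewrite arE /ar /B -!exprM mulnC.
    have -> : x ^+ d = x ^+ m.+2 by rewrite dm.
    by rewrite -(exprM B 2 2); exact: hx.
  apply: (le_trans (sep_le _ _ (z / ar) (w / ar) _ _ _)).
  + by rewrite ltr_pM2r ?invr_gt0.
  + by apply: rt => //; lra.
  + exact: rt.
  rewrite -mulrBl ler_pdivrMr //; apply: (le_trans wz).
  rewrite ler_pdivrMr ?exprn_gt0 //; last lra.
  (* On both sides b has exponent 2m^2 + 5m + 4. *)
  have be : b%:R ^+ (m * (2 * m + 3)) * B ^+ 2 = ar * B ^+ (2 * m).+1.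
    rewrite /B /ar -(exprM _ d 2) -(exprM _ d (2 * m).+1) -2!exprD.
    by congr (_ ^+ _); rewrite dm -[m.+2]addn2 -[(2 * m).+1]addn1; ring.
  rewrite -[leRHS]mulrA -be [leRHS]mulrA divfK // expf_neq0 // gt_eqF //; lra.
- have := height_catalan_family_le _ _ _ _ sT sG a1.
  rewrite -/Q -(ler_int R) rmorphM /= -/C2 rmorphXn /= => h; apply: (le_trans h).
  rewrite /a rmorphXn -exprM /=.
  by rewrite dm mulnA.
Qed.
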